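(* Let $(X,d)$ be a metric space with basepoint $e\in X$, and assume that $e$ is an isolated point of $X$. Then the matching distance $d_{\mathbb{N}[X]}$ induces on $\mathrm{SP}(X)$ the same topology as the direct-limit topology.
   Context: Let $(X,d)$ be a metric space with distinguished basepoint $e\in X$. For $n\ge 1$, $\mathrm{SP}^n(X)=X^n/S_n$ is the quotient (with the quotient topology) of the product space $X^n$ by the coordinate-permutation action of the symmetric group $S_n$; the orbit of $(x_1,\dots,x_n)$ is written $[x_1,\dots,x_n]$. The map $[x_1,\dots,x_n]\mapsto[x_1,\dots,x_n,e]$ embeds $\mathrm{SP}^n(X)$ in $\mathrm{SP}^{n+1}(X)$, and the infinite symmetric product $\mathrm{SP}(X)$ is the union $\bigcup_{n\ge1}\mathrm{SP}^n(X)$ of the increasing sequence so obtained. Thus elements of $\mathrm{SP}(X)$ are finite unordered lists $[x_1,\dots,x_m]$ of points of $X$, with $[x_1,\dots,x_m]=[x_1,\dots,x_m,e]$. The direct-limit topology on $\mathrm{SP}(X)$ is the finest topology making all inclusions $\mathrm{SP}^n(X)\hookrightarrow\mathrm{SP}(X)$ continuous; equivalently, $U\subseteq \mathrm{SP}(X)$ is open iff $U\cap\mathrm{SP}^n(X)$ is open in $\mathrm{SP}^n(X)$ for every $n$. Matching distance: for $[x_1,\dots,x_m],[y_1,\dots,y_n]\in \mathrm{SP}(X)$ and $N\ge m+n$ let $\mathbf{x}_N=(x_1,\dots,x_m,e,\dots,e)$ and $\mathbf{y}_N=(y_1,\dots,y_n,e,\dots,e)$ be the lists padded with copies of $e$ to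 length $N$, and let $\mathbf{x}_N(i)$, $\mathbf{y}_N(i)$ be their $i$-th entries. Then $$d_{\mathbb{N}[X]}([x_1,\dots,x_m],[y_1,\dots,y_n]):=\inf_{N\ge m+n}\ \min_{\sigma\in S_N}\ \sum_{i=1}^N d\bigl(\mathbf{x}_N(i),\mathbf{y}_N(\sigma(i))\bigr),$$ which is a well-defined metric on the set $\mathrm{SP}(X)$. *)

(* Defs.v *)
From HB Require Import structures.
From mathcomp Require Import all_boot all_order all_fingroup all_algebra.
From mathcomp Require Import all_classical all_reals all_analysis.
(* Imported last: [repr] is the representative of a class, not of a set in a
   finite group. *)
From mathcomp Require Import generic_quotient.

Set Implicit Arguments.
Unset Strict Implicit.
Unset Printing Implicit Defensive.

Import Order.TTheory GRing.Theory Num.Theory.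

Local Open Scope classical_set_scope.
Local Open Scope ring_scope.
Local Open Scope quotient_scope.

Section FiniteSymmetricProduct.
Variables (X : topologicalType) (n : nat).

Definition cartesian_power : Type := prod_topology (fun _ : 'I_n => X).
HB.instance Definition _ := Topological.on cartesian_power.

Definition orbit_rel (x y : cartesian_power) : bool :=
  [exists s : 'S_n, [forall i, y i == x (s i)]].

Lemma orbit_relP (x y : cartesian_power) :
  reflect (exists s : 'S_n, forall i, y i = x (s i)) (orbit_rel x y).
Proof.
apply: (iffP existsP) => -[s sP]; exists s.
  by move=> i; apply/eqP; move/forallP: sP; exact.
by apply/forallP => i; apply/eqP.
Qed.

Lemma orbit_rel_refl : reflexive orbit_rel.
Proof. by move=> x; apply/orbit_relP; exists 1%g => i; rewrite perm1. Qed.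

Lemma orbit_rel_sym : symmetric orbit_rel.
Proof.
move=> x y; apply/idP/idP => /orbit_relP[s sP]; apply/orbit_relP;
  by exists (s^-1)%g => i; rewrite sP permKV.
Qed.

Lemma orbit_rel_trans : transitive orbit_rel.
Proof.
move=> y x z /orbit_relP[s sP] /orbit_relP[t tP]; apply/orbit_relP.
by exists (t * s)%g => i; rewrite tP sP permM.
Qed.

Canonical orbit_equiv :=
  EquivRel orbit_rel orbit_rel_refl orbit_rel_sym orbit_rel_trans.

Definition SPn : Type := quotient_topology {eq_quot orbit_rel}.
HB.instance Definition _ := Topological.on SPn.
HB.instance Definition _ := Quotient.on SPn.

End FiniteSymmetricProduct.

Section SymmetricProduct.
Variables (X : topologicalType) (e : X).

(* Both sides have length [size s + size t]: the lists are padded with copies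
   of the basepoint to a common length and compared up to order. *)
Definition padded_perm (s t : seq X) : bool :=
  perm_eq (s ++ nseq (size t) e) (t ++ nseq (size s) e).

Lemma padded_permP s t :
  reflect (forall x, x != e -> count_mem x s = count_mem x t)
          (padded_perm s t).
Proof.
apply: (iffP idP) => [/seq.permP st x xe|st].
  have := st (pred1 x); rewrite !count_cat !count_nseq /=.
  by rewrite [e == x]eq_sym (negbTE xe) !mul0n !addn0.
have f (r : seq X) : (count_mem e r + count (predC (pred1 e)) r = size r)%N.
  exact: count_predC.
have g : count (predC (pred1 e)) s = count (predC (pred1 e)) t.
  rewrite -!size_filter; apply: perm_size; apply/allP => x _ /=.
  rewrite !count_filter; have [->|xe] := eqVneq x e.
    have h r : count [predI pred1 e & predC (pred1 e)] r = 0%N.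
      by rewrite (@eq_count _ _ pred0) ?count_pred0// => y /=; rewrite andbN.
    by rewrite !h.
  have h r : count [predI pred1 x & predC (pred1 e)] r = count_mem x r.
    by apply: eq_count => y /=; rewrite !inE; have [->|_] := eqVneq y x;
      rewrite ?eqxx ?xe.
  by rewrite !h st.
apply/allP => x _ /=; apply/eqP.
rewrite !count_cat !count_nseq /=; have [->|xe] := eqVneq x e.
  by rewrite /= !mul1n -(f s) -(f t) g addnCA.
by rewrite /= !mul0n !addn0 st.
Qed.

Lemma padded_perm_refl : reflexive padded_perm.
Proof. by move=> s; apply/padded_permP. Qed.

Lemma padded_perm_sym : symmetric padded_perm.
Proof. by move=> s t; rewrite /padded_perm perm_sym. Qed.

Lemma padded_perm_trans : transitive padded_perm.
Proof.
move=> t s r /padded_permP st /padded_permP tr; apply/padded_permP => x xe.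
by rewrite st// tr.
Qed.

Canonical padded_perm_equiv :=
  EquivRel padded_perm padded_perm_refl padded_perm_sym padded_perm_trans.

Definition SP : Type := {eq_quot padded_perm}.
HB.instance Definition _ := Choice.on SP.
HB.instance Definition _ := EqQuotient.on SP.

Definition SP_of_seq (s : seq X) : SP := \pi_SP s.

Definition SP_incl (n : nat) (z : SPn X n) : SP := SP_of_seq (codom (repr z)).

Lemma SP_of_seqP s t : SP_of_seq s = SP_of_seq t <-> padded_perm s t.
Proof. by split => [/eqquotP|st]; [|exact/eqquotP]. Qed.

Lemma SP_of_seq_rcons s : SP_of_seq (rcons s e) = SP_of_seq s.
Proof.
apply/SP_of_seqP/padded_permP => x xe.
by rewrite -cats1 count_cat /= eq_sym (negbTE xe) !addn0.
Qed.

Lemma perm_codom_orbit n (x y : cartesian_power X n) :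
  perm_eq (codom x) (codom y) <-> orbit_rel x y.
Proof.
have cE (z : cartesian_power X n) : codom z = [tuple z i | i < n] by [].
split.
  rewrite perm_sym (cE x) => /tuple_permP[p yE]; apply/orbit_relP.
  exists p => i.
  have := congr1 (fun r => nth (x i) r i) yE.
  rewrite cE -!tnth_nth !tnth_mktuple; exact.
move=> /orbit_relP[p yE]; rewrite perm_sym (cE x); apply/tuple_permP.
exists p; rewrite cE; congr (tval _); apply: eq_from_tnth => i.
by rewrite !tnth_mktuple yE.
Qed.

Lemma SP_inclE n (x : cartesian_power X n) :
  SP_incl (\pi_(SPn X n) x) = SP_of_seq (codom x).
Proof.
apply/SP_of_seqP; rewrite /padded_perm !size_codom perm_cat2r.
apply/perm_codom_orbit; rewrite -/(orbit_equiv X n _ _).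
by apply/eqmodP; exact: (reprK (\pi_(SPn X n) x)).
Qed.

Lemma SP_incl_inj n : injective (@SP_incl n).
Proof.
move=> y z /SP_of_seqP; rewrite /padded_perm !size_codom perm_cat2r.
move=> /perm_codom_orbit yz; rewrite -[y]reprK -[z]reprK.
by apply/(@eqmodP _ (orbit_equiv X n)).
Qed.

End SymmetricProduct.

Section DirectLimitTopology.
Variables (X : topologicalType) (e : X).

Definition SPlim : Type := SP e.
HB.instance Definition _ := Choice.on SPlim.

Definition SPlim_open (U : set SPlim) : Prop :=
  forall n, (0 < n)%N -> open (@SP_incl X e n @^-1` U).

Let SPlim_openT : SPlim_open setT.
Proof. by move=> n _; rewrite preimage_setT; exact: openT. Qed.

Let SPlim_openI : setI_closed SPlim_open.
Proof.
by move=> U V oU oV n n0; rewrite preimage_setI; apply: openI;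
  [exact: oU|exact: oV].
Qed.

Let SPlim_open_bigU (I : Type) (f : I -> set SPlim) :
  (forall i, SPlim_open (f i)) -> SPlim_open (\bigcup_i f i).
Proof.
move=> of_ n n0; rewrite preimage_bigcup; apply: bigcup_open => i _.
exact: of_.
Qed.

HB.instance Definition _ :=
  isOpenTopological.Build SPlim SPlim_openT SPlim_openI SPlim_open_bigU.

End DirectLimitTopology.

Section MatchingDistance.
Variables (R : realType) (X : metricType R) (e : X).
Implicit Types (u v w : nat -> X) (s t r : seq X).

Definition matching_cost (N : nat) u v (p : 'S_N) : R :=
  \sum_(i < N) mdist (u i) (v (p i)).

Definition min_matching_cost (N : nat) u v : R :=
  \big[Num.min/matching_cost u v (1%g : 'S_N)]_(p : 'S_N) matching_cost u v p.

(* [nth e s] is [s] padded with infinitely many copies of [e]. *)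
Definition matching_dist_seq s t : R :=
  inf [set min_matching_cost N (nth e s) (nth e t) |
       N in [set N | (size s + size t <= N)%N]].

Definition matching_dist (x y : SP e) : R :=
  matching_dist_seq (repr x) (repr y).

Lemma min_matching_cost_le N u v (p : 'S_N) :
  min_matching_cost N u v <= matching_cost u v p.
Proof. exact: bigmin_le. Qed.

Lemma min_matching_costP N u v :
  exists p : 'S_N, min_matching_cost N u v = matching_cost u v p.
Proof.
rewrite /min_matching_cost.
apply: (big_ind (fun x => exists p : 'S_N, x = matching_cost u v p)).
- by exists 1%g.
- by move=> x y [p ->] [q ->]; rewrite /Num.min; case: ifP; [exists p|exists q].
- by move=> p _; exists p.
Qed.

Lemma matching_cost_ge0 N u v (p : 'S_N) : 0 <= matching_cost u v p.
Proof. by apply: sumr_ge0 => i _; exact: mdist_ge0. Qed.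

Lemma min_matching_cost_ge0 N u v : 0 <= min_matching_cost N u v.
Proof.
by have [p ->] := min_matching_costP N u v; exact: matching_cost_ge0.
Qed.

Lemma min_matching_cost_sym N u v :
  min_matching_cost N u v = min_matching_cost N v u.
Proof.
wlog suff H : u v / min_matching_cost N u v <= min_matching_cost N v u.
  by apply/eqP; rewrite eq_le !H.
have [p ->] := min_matching_costP N v u.
apply: le_trans (min_matching_cost_le u v p^-1%g) _.
rewrite /matching_cost (reindex_inj (@perm_inj _ p)) /=.
by apply: ler_sum => i _; rewrite permK metric_sym.
Qed.

Lemma min_matching_cost_triangle N v u w :
  min_matching_cost N u w <= min_matching_cost N u v + min_matching_cost N v w.
Proof.
have [p ->] := min_matching_costP N u v.
have [q ->] := min_matching_costP N v w.
apply: le_trans (min_matching_cost_le u w (p * q)%g) _.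
rewrite /matching_cost.
rewrite [X in _ <= _ + X](reindex_inj (@perm_inj _ p)) /= -big_split /=.
by apply: ler_sum => i _; rewrite permM; exact: metric_triangle.
Qed.

Lemma min_matching_cost_eq0 N u v :
  min_matching_cost N u v = 0 <-> perm_eq (mkseq u N) (mkseq v N).
Proof.
have mkE w : mkseq w N = [tuple w i | i < N].
  by rewrite /mkseq -val_enum_ord -map_comp.
split.
  have [p ->] := min_matching_costP N u v.
  move=> /psumr_eq0P uv; rewrite (mkE v); apply/tuple_permP; exists p.
  rewrite mkE; congr (tval _); apply: eq_from_tnth => i.
  rewrite !tnth_mktuple; apply: mdist_positivity.
  by apply: uv => // j _; exact: mdist_ge0.
rewrite (mkE v) => /tuple_permP[p]; rewrite mkE => uv.
apply/eqP; rewrite eq_le min_matching_cost_ge0 andbT.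
apply: le_trans (min_matching_cost_le u v p) _.
rewrite /matching_cost big1// => i _.
have := congr1 (fun r => nth (u i) r i) uv.
by rewrite -!tnth_nth !tnth_mktuple => <-; exact: mdistxx.
Qed.

Lemma min_matching_costS N u v : u N = e -> v N = e ->
  min_matching_cost N.+1 u v = min_matching_cost N u v.
Proof.
move=> uN vN.
have liftE (p : 'S_N.+1) (q : 'S_N) :
    (forall i, p (lift ord_max i) = lift ord_max (q i)) ->
    p ord_max = ord_max ->
    matching_cost u v p = matching_cost u v q.
  move=> pq pmax; rewrite /matching_cost big_ord_recr /= pmax /= uN vN mdistxx.
  rewrite addr0; apply: eq_bigr => i _.
  have -> : widen_ord (leqnSn N) i = lift ord_max i.
    by apply: val_inj; rewrite [RHS]lift_max.
  by rewrite pq lift_max.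
apply/eqP; rewrite eq_le; apply/andP; split.
  have [q ->] := min_matching_costP N u v.
  rewrite -(liftE (lift_perm ord_max ord_max q)).
  - exact: min_matching_cost_le.
  - by move=> i; rewrite lift_perm_lift.
  - by rewrite lift_perm_id.
have [p ->] := min_matching_costP N.+1 u v.
pose q : 'S_N.+1 := (p * tperm (p ord_max) ord_max)%g.
have qmax : q ord_max = ord_max by rewrite permM tpermL.
have qp : matching_cost u v q <= matching_cost u v p.
  have [pmax|pmax] := eqVneq (p ord_max) ord_max.
    by rewrite /q pmax tperm1 mulg1.
  pose k := (p^-1)%g ord_max.
  have pk : p k = ord_max by rewrite permKV.
  have kmax : k != ord_max by apply: contra_neq pmax => kE; rewrite -{1}kE pk.
  have splitE (r : 'S_N.+1) : matching_cost u v r =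
      mdist (u N) (v (r ord_max)) + mdist (u k) (v (r k)) +
      \sum_(i | (i != ord_max) && (i != k)) mdist (u i) (v (r i)).
    by rewrite /matching_cost (bigD1 ord_max)//= (bigD1 k)//= addrA.
  rewrite !splitE.
  apply: lerD.
    rewrite qmax /= uN vN mdistxx add0r permM pk tpermR /= vN addrC.
    exact: metric_triangle.
  apply: ler_sum => i /andP[imax ik]; rewrite permM tpermD//.
    by rewrite (inj_eq perm_inj) eq_sym.
  by rewrite -pk (inj_eq perm_inj) eq_sym.
apply: le_trans qp.
pose f (i : 'I_N) : 'I_N := odflt i (unlift ord_max (q (lift ord_max i))).
have fE i : q (lift ord_max i) = lift ord_max (f i).
  rewrite /f; case: unliftP => [j //|/eqP].
  by rewrite -{2}qmax (inj_eq perm_inj) eq_sym (negbTE (neq_lift _ _)).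
have f_inj : injective f.
  move=> i j fij; apply: (@lift_inj _ ord_max); apply: (@perm_inj _ q).
  by rewrite !fE fij.
rewrite (liftE q (perm f_inj)) //; first exact: min_matching_cost_le.
by move=> i; rewrite fE [perm f_inj i]permE.
Qed.

Lemma matching_dist_seqE N s t : (size s <= N)%N -> (size t <= N)%N ->
  matching_dist_seq s t = min_matching_cost N (nth e s) (nth e t).
Proof.
have stab M k : (size s <= M)%N -> (size t <= M)%N ->
    min_matching_cost (M + k) (nth e s) (nth e t) =
    min_matching_cost M (nth e s) (nth e t).
  move=> sM tM; elim: k => [|k IH]; first by rewrite addn0.
  by rewrite addnS min_matching_costS// nth_default//;
    [exact: leq_trans sM (leq_addr _ _)|exact: leq_trans tM (leq_addr _ _)].
move=> sN tN; rewrite /matching_dist_seq -[RHS]inf1; congr inf.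
have E M : (size s + size t <= M)%N ->
    min_matching_cost M (nth e s) (nth e t) =
    min_matching_cost N (nth e s) (nth e t).
  move=> stM; rewrite -(stab N M)// addnC stab//.
    by rewrite (leq_trans _ stM)// leq_addr.
  by rewrite (leq_trans _ stM)// leq_addl.
apply/seteqP; split => [_ [M /= stM <-]|_ ->] /=; first exact: E.
by exists (size s + size t)%N; [exact: leqnn|exact: E].
Qed.

Lemma mkseq_pad N s : (size s <= N)%N ->
  mkseq (nth e s) N = s ++ nseq (N - size s) e.
Proof.
move=> sN; apply: (@eq_from_nth _ e).
  by rewrite size_mkseq size_cat size_nseq subnKC.
move=> i; rewrite size_mkseq => iN; rewrite nth_mkseq// nth_cat.
by case: ltnP => // si; rewrite nth_default// nth_nseq if_same.
Qed.

Lemma matching_dist_seq_eq0 s t :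
  matching_dist_seq s t = 0 <-> padded_perm e s t.
Proof.
rewrite (@matching_dist_seqE (size s + size t)%N) ?leq_addr ?leq_addl//.
by rewrite min_matching_cost_eq0 !mkseq_pad ?leq_addr ?leq_addl// addKn addnK.
Qed.

Lemma matching_dist_seq_sym s t : matching_dist_seq s t = matching_dist_seq t s.
Proof.
rewrite !(@matching_dist_seqE (size s + size t)%N) ?leq_addr ?leq_addl//.
exact: min_matching_cost_sym.
Qed.

Lemma matching_dist_seq_triangle t s r :
  matching_dist_seq s r <= matching_dist_seq s t + matching_dist_seq t r.
Proof.
pose N := (size s + size t + size r)%N.
have sN : (size s <= N)%N by rewrite /N -addnA leq_addr.
have tN : (size t <= N)%N by rewrite /N addnAC leq_addl.
have rN : (size r <= N)%N by rewrite /N leq_addl.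
rewrite !(@matching_dist_seqE N)//; exact: min_matching_cost_triangle.
Qed.

Lemma matching_distE s t :
  matching_dist (SP_of_seq e s) (SP_of_seq e t) = matching_dist_seq s t.
Proof.
pose rep r := repr (SP_of_seq e r).
have rep0 r : matching_dist_seq (rep r) r = 0.
  by apply/matching_dist_seq_eq0/SP_of_seqP; exact: reprK.
have rep0' r : matching_dist_seq r (rep r) = 0.
  by rewrite matching_dist_seq_sym.
apply/eqP; rewrite eq_le; apply/andP; split; rewrite /matching_dist -!/(rep _).
  apply: le_trans (matching_dist_seq_triangle s _ _) _; rewrite rep0 add0r.
  by apply: le_trans (matching_dist_seq_triangle t _ _) _; rewrite rep0' addr0.
apply: le_trans (matching_dist_seq_triangle (rep s) _ _) _; rewrite rep0' add0r.
apply: le_trans (matching_dist_seq_triangle (rep t) _ _) _.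
by rewrite rep0 addr0.
Qed.

Definition SPmatch : Type := SP e.
HB.instance Definition _ := Choice.on SPmatch.

Let matching_distxx (x : SPmatch) : matching_dist x x = 0.
Proof. exact/matching_dist_seq_eq0/padded_perm_refl. Qed.

Let matching_dist_positivity (x y : SPmatch) : matching_dist x y = 0 -> x = y.
Proof.
by move=> /matching_dist_seq_eq0 /SP_of_seqP; rewrite /SP_of_seq !reprK.
Qed.

Let matching_dist_sym (x y : SPmatch) : matching_dist x y = matching_dist y x.
Proof. exact: matching_dist_seq_sym. Qed.

Let matching_dist_triangle (y x z : SPmatch) :
  matching_dist x z <= matching_dist x y + matching_dist y z.
Proof. exact: matching_dist_seq_triangle. Qed.

HB.instance Definition _ := isMetric.Build R SPmatch
  matching_distxx matching_dist_positivity matching_dist_sym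
  matching_dist_triangle.

End MatchingDistance.

(* Main.v *)
Require Import Defs.
From mathcomp Require Import all_boot all_order all_fingroup all_algebra.
From mathcomp Require Import all_classical all_reals all_analysis.
From mathcomp Require Import generic_quotient.

(** Both topologies are tested on the finite powers of [X].  A set [U] is open
    for the direct limit iff for each [n > 0] the set of tuples of length [n]
    whose class lies in [U] is open in the product, that is
    ([SPlim_openP], [nbhs_cartesian_powerP]) around each of its points it
    contains a box of some radius [d > 0].

    Matching-open sets are open for the direct limit over any [X]: moving each
    of [n] coordinates by less than [d] costs at most [n * d] under the
    identity matching ([matching_dist_codom_lt]).

    The converse is where the isolation of [e] enters.  Let [d] be so small
    that [e] is the only point within [d] of [e].  If a list [t] is at matching
    distance less than [d] from a list [s] of length at most [n], then in an
    optimal matching every padding entry of [s] is matched to a point within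
    [d] of [e], hence to [e] itself.  So, whatever its length, [t] is, up to
    order and copies of [e], the list of the [n] entries matched to those of
    [s], each of them within [d] of its partner ([matching_dist_seq_lt_tuple]).
    A single radius chosen in the [n]-th power of [X] therefore controls all
    the larger powers at once. *)

Set Implicit Arguments.
Unset Strict Implicit.
Unset Printing Implicit Defensive.

Import Order.TTheory GRing.Theory Num.Theory.

Local Open Scope classical_set_scope.
Local Open Scope ring_scope.

Lemma open_mdistP (R : realType) (M : metricType R) (U : set M) :
  open U <-> forall x, U x ->
    exists2 d : R, 0 < d & forall y, mdist x y < d -> U y.
Proof.
by rewrite openE; split=> oU x /oU; rewrite /interior -metricType_numDomainType.filter_from_mdist_nbhs.
Qed.

Lemma isolated_mdistP (R : realType) (M : metricType R) (e : M) :
  isolated [set: M] e ->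
  exists2 d : R, 0 < d & forall y, mdist e y < d -> y = e.
Proof.
move=> [_ [V]]; rewrite setIT => /[swap] ->.
by rewrite -metricType_numDomainType.filter_from_mdist_nbhs => -[d d0 dV]; exists d.
Qed.

(** The product topology is the supremum of the topologies pulled back along the
    coordinates, so it suffices that the filter of boxes converges coordinate
    by coordinate; conversely boxes are neighbourhoods because there are only
    finitely many coordinates. *)
Lemma nbhs_cartesian_powerP (R : realType) (X : metricType R) n
    (x : cartesian_power X n) (A : set (cartesian_power X n)) :
  nbhs x A <-> exists2 d : R, 0 < d &
    forall y : cartesian_power X n, (forall i, mdist (x i) (y i) < d) -> A y.
Proof.
pose box (d : R) : set (cartesian_power X n) :=
  [set y | forall i, mdist (x i) (y i) < d].
split.
  pose F := filter_from [set d : R | 0 < d] box.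
  have FF : Filter F.
    apply: filter_from_filter; first by exists 1 => /=.
    move=> a b a0 b0; exists (Num.min a b); first by rewrite /= lt_min a0.
    by move=> y yab; split=> i; have := yab i; rewrite lt_min => /andP[].
  suff: F --> (x : prod_topology (fun _ : 'I_n => X)).
    by move=> + xA => /(_ A xA).
  apply/cvg_sup => i B [/= _ [[W oW <-]] /= Wx] WB.
  have [d d0 dW] := (open_mdistP W).1 oW _ Wx.
  by exists d => // y yd; apply: WB; exact: dW.
move=> [d d0 dA]; apply: (filterS dA).
apply: (@filter_forall _ _ (fun i y => mdist (x i) (y i) < d) (nbhs x)) => i.
have := @proj_continuous 'I_n (fun=> X) i x [set z | mdist (x i) z < d].
by apply; rewrite /= -metricType_numDomainType.filter_from_mdist_nbhs; exists d.
Qed.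

(** Open sets of the quotient by permutations are those with open preimage, so
    the quotient can be bypassed in favour of the product. *)
Lemma SPlim_openP (X : topologicalType) (e : X) (U : set (SP e)) :
  open (U : set (SPlim e)) <-> forall n, (0 < n)%N ->
    open [set y : cartesian_power X n | U (SP_of_seq e (codom y))].
Proof.
have preE n : [set y : cartesian_power X n | U (SP_of_seq e (codom y))] =
    \pi_(SPn X n)%qT @^-1` (@SP_incl X e n @^-1` U).
  by apply/seteqP; split=> y /=; rewrite SP_inclE.
change (open (U : set (SPlim e))) with (SPlim_open U).
by split=> oU n n0; have := oU n n0; rewrite preE.
Qed.

Lemma nth_codom_ord (T : Type) (a : T) n (f : 'I_n -> T) (i : 'I_n) :
  nth a (codom f) i = f i.
Proof. by rewrite codomE (nth_map i) ?size_enum_ord// nth_ord_enum. Qed.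

Lemma matching_dist_codom_lt (R : realType) (X : metricType R) (e : X) n
    (x y : cartesian_power X n) (d : R) : (0 < n)%N ->
  (forall i, mdist (x i) (y i) < d) ->
  matching_dist (SP_of_seq e (codom x)) (SP_of_seq e (codom y)) < d *+ n.
Proof.
move=> n0 xyd; rewrite matching_distE (@matching_dist_seqE _ _ _ n);
  rewrite ?size_codom ?card_ord//.
apply: (le_lt_trans (min_matching_cost_le _ _ 1%g)).
rewrite /matching_cost.
have -> : d *+ n = \sum_(i < n) d by rewrite sumr_const card_ord.
apply: ltr_sum; last by move=> i _; rewrite perm1 !nth_codom_ord.
by apply/hasP; exists (Ordinal n0); rewrite ?mem_index_enum.
Qed.

(** A cheap matching sends all the padding of [s] to the isolated basepoint, so
    the [n] entries of [t] matched with the first [n] entries of [s] represent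
    all of [t]. *)
Lemma matching_dist_seq_lt_tuple (R : realType) (X : metricType R) (e : X)
    (d : R) n (s t : seq X) :
  (forall y, mdist e y < d -> y = e) -> (size s <= n)%N ->
  matching_dist_seq e s t < d ->
  exists2 y : cartesian_power X n,
    (forall i : 'I_n, mdist (nth e s i) (y i) < d) &
    SP_of_seq e (codom y) = SP_of_seq e t.
Proof.
move=> eiso sn.
(* Written as a sum so that the first [n] indices form a block of ['I_N]. *)
pose N := (n + size t)%N.
have tN : (size t <= N)%N by exact: leq_addl.
rewrite (@matching_dist_seqE _ _ _ N) ?(leq_trans sn (leq_addr _ _))//.
have [p ->] := min_matching_costP N (nth e s) (nth e t) => pd.
have ppd (i : 'I_N) : mdist (nth e s i) (nth e t (p i)) < d.
  apply: le_lt_trans pd; rewrite /matching_cost (bigD1 i)//= lerDl.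
  by apply: sumr_ge0 => j _; exact: mdist_ge0.
exists (fun i => nth e t (p (lshift (size t) i))).
  by move=> i; exact: ppd (lshift _ i).
apply/SP_of_seqP/padded_permP => x xe.
have tE : perm_eq [seq nth e t (p i) | i : 'I_N] (t ++ nseq (N - size t) e).
  rewrite -mkseq_pad//.
  have -> : mkseq (nth e t) N = [tuple nth e t i | i < N].
    by rewrite /mkseq -val_enum_ord -map_comp.
  apply/tuple_permP; exists p.
  by apply: eq_map => i; rewrite tnth_mktuple.
have /(_ (pred1 x)) := seq.permP tE.
rewrite count_cat count_nseq /= eq_sym (negbTE xe) mul0n addn0 => <-.
rewrite -!sum1_count /codom !big_image_cond big_split_ord /=.
(* Entries matched to padding of [s] equal [e], so they do not count for [x]. *)
rewrite [X in (_ + X)%N]big_pred0 ?addn0// => j.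
have := ppd (rshift n j); rewrite nth_default ?(leq_trans sn (leq_addr _ _))//.
by move=> /eiso ->; rewrite eq_sym; exact: negbTE.
Qed.

Theorem theorem3p8 (R : realType) (X : metricType R) (e : X) :
  isolated [set: X] e ->
  forall U : set (SP e), open (U : set (SPmatch e)) <-> open (U : set (SPlim e)).
Proof.
move=> /isolated_mdistP[r r0 eiso] U; rewrite SPlim_openP; split.
  move=> /open_mdistP oU n n0; rewrite openE => x /oU[d d0 dU].
  apply/nbhs_cartesian_powerP; exists (d / n%:R).
    by rewrite divr_gt0// ltr0n.
  move=> y /(matching_dist_codom_lt e n0).
  rewrite -[_ *+ _]mulr_natr divfK ?pnatr_eq0 ?gtn_eqF//; exact: dU.
move=> oU; apply/open_mdistP => z Uz.
pose s := repr (z : SP e).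
(* The direct limit only tests positive powers, and [s] may be empty. *)
pose n := (size s).+1.
pose x : cartesian_power X n := fun i => nth e s i.
have xz : SP_of_seq e (codom x) = z.
  have -> : codom x = mkseq (nth e s) n.
    by rewrite /mkseq -val_enum_ord -map_comp.
  rewrite mkseq_pad// subSn// subnn cats1 SP_of_seq_rcons.
  exact: reprK.
have := oU n isT; rewrite openE => /(_ x); rewrite /= xz => /(_ Uz).
move=> /nbhs_cartesian_powerP[d d0 dU].
exists (Num.min d r) => [|w zw]; first by rewrite lt_min d0.
have [|||y yd yw] := @matching_dist_seq_lt_tuple _ _ e (Num.min d r) n s (repr (w : SP e)).
- by move=> y; rewrite lt_min => /andP[_ /eiso].
- exact: leqnSn.
- exact: zw.
have -> : w = SP_of_seq e (codom y) by rewrite yw; exact/esym/reprK.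
by apply: dU => i; have := yd i; rewrite lt_min => /andP[].
Qed.
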